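(* For every pair of positive integers $k,h$ there exists an integer $\phi(k,h)$, depending only on $k$ and $h$, such that every asymptotic basis $A$ for $\mathbb{N}_0$ of order $h$ has at most $\phi(k,h)$ essential subsets of size at most $k$.
   Context: All sets are subsets of $\mathbb{N}_0=\{0,1,2,\dots\}$. For $A\subseteq\mathbb{N}_0$ with $0\in A$ and an integer $h\ge 1$, $hA=\{a_1+\cdots+a_h : a_1,\dots,a_h\in A\}$. A set $B\subseteq\mathbb{N}_0$ is an asymptotic basis of order $h$ if all but finitely many non-negative integers can be written as a sum of at most $h$ elements of $B$ (for $0\in B$ this says $\mathbb{N}_0\setminus hB$ is finite); $B$ is an asymptotic basis (of some order) if it is one of order $h$ for some $h$. If $A$ is an asymptotic basis, an essentiality of $A$ is a subset $P\subseteq A$ such that $A\setminus P$ is not an asymptotic basis of any order, and $P$ is minimal with respect to inclusion among subsets of $A$ with this property. A finite essentiality is called an essential subset of $A$. *)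

(* Defs.v *)
From mathcomp Require Import all_boot.
From mathcomp Require Import boolp classical_sets cardinality.

Set Implicit Arguments.
Unset Strict Implicit.
Unset Printing Implicit Defensive.

Local Open Scope classical_set_scope.

(* Summands may repeat; the empty sum 0 is always included, which does not
   affect cofiniteness. *)
Definition sums_at_most (h : nat) (B : set nat) : set nat :=
  [set n | exists s : seq nat,
     [/\ (size s <= h)%N, (forall x, x \in s -> B x) & n = sumn s]].

Definition asymptotic_basis_of_order (h : nat) (B : set nat) : Prop :=
  finite_set (~` sums_at_most h B).

Definition asymptotic_basis (B : set nat) : Prop :=
  exists2 h, (0 < h)%N & asymptotic_basis_of_order h B.

Definition essentiality (A P : set nat) : Prop :=
  [/\ asymptotic_basis A,
      P `<=` A,
      ~ asymptotic_basis (A `\` P) &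
      forall Q : set nat, Q `<=` A -> ~ asymptotic_basis (A `\` Q) ->
        Q `<=` P -> Q = P].

Definition essential_subset (A P : set nat) : Prop :=
  essentiality A P /\ finite_set P.

(* Main.v *)
Require Import Defs.
From mathcomp Require Import all_boot.
From mathcomp Require Import boolp classical_sets cardinality.
From mathcomp Require Import finmap zify.

Local Open Scope classical_set_scope.
Local Open Scope card_scope.

(** For finite [P], the set [A \ P] is a basis as soon as no prime divides all
    of its elements: then [A \ P] has two consecutive sums [s] and [s + 1], and
    in a representation of [n - V s], with [V] an upper bound for the
    contribution [v] of [P], one trades [v + V s] for
    [v (s + 1) + (V - v) s].  By minimality every essential subset is thus
    [{a in A | p does not divide a}] for some prime [p].

    Given [N] essential subsets of size at most [k], let [q >= 2 ^ N] be the
    product of the corresponding primes.  Modulo [q] all but [k N] elements of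
    [A] vanish, while every residue is a sum of at most [h] elements of [A],
    so [2 ^ N <= (k N + 1) ^ h], which bounds [N]. *)

Lemma finite_setCP (X : set nat) :
  finite_set (~` X) <-> exists M, forall n, (M <= n)%N -> X n.
Proof.
split=> [/finite_seqP[s sE]|[M XM]].
  exists (\max_(i <- s) i).+1 => n ltn; apply: contrapT => /= nX.
  have : (~` X) n by [].
  rewrite sE /= => ns.
  by have := @leq_bigmax_seq _ s xpredT id n ns isT; rewrite leqNgt ltn.
apply: (sub_finite_set _ (finite_II M)) => n /= nX.
by rewrite ltnNge; apply/negP => /XM.
Qed.

Lemma sums_at_mostW (h h' : nat) (B : set nat) (n : nat) :
  (h <= h')%N -> sums_at_most h B n -> sums_at_most h' B n.
Proof. by move=> le [s [sh sB nE]]; exists s; split=> //; apply: leq_trans le. Qed.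

Lemma sums_at_mostD (h1 h2 : nat) (B : set nat) (m n : nat) :
  sums_at_most h1 B m -> sums_at_most h2 B n ->
  sums_at_most (h1 + h2) B (m + n).
Proof.
move=> [s [sh sB ->]] [t [th tB ->]]; exists (s ++ t); split.
- by rewrite size_cat leq_add.
- by move=> x; rewrite mem_cat => /orP[/sB|/tB].
- by rewrite sumn_cat.
Qed.

Lemma sums_at_mostM (h m : nat) (B : set nat) (n : nat) :
  sums_at_most h B n -> sums_at_most (m * h) B (m * n).
Proof.
move=> hn; elim: m => [|m IH]; first by rewrite !mul0n; exists [::]; split.
by rewrite !mulSn; apply: sums_at_mostD.
Qed.

Lemma sums_at_most1 (B : set nat) (b : nat) : B b -> sums_at_most 1 B b.
Proof.
by move=> Bb; exists [:: b]; split=> [//|x|/=]; rewrite ?inE ?addn0 // => /eqP->.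
Qed.

Lemma dvdn_sumn (d : nat) (s : seq nat) :
  (forall x, x \in s -> (d %| x)%N) -> (d %| sumn s)%N.
Proof. by move=> ds; rewrite sumnE big_seq; apply: dvdn_sum => x /ds. Qed.

Lemma not_asymptotic_basis_dvd (p : nat) (B : set nat) :
  prime p -> (forall b, B b -> (p %| b)%N) -> ~ asymptotic_basis B.
Proof.
move=> p_pr pB [h _ /finite_setCP[M BM]].
have [|s [_ sB sE]] := BM (p * M + 1)%N; first by have := prime_gt0 p_pr; nia.
have : (p %| p * M + 1)%N by rewrite sE; apply: dvdn_sumn => x /sB /pB.
by rewrite dvdn_addr ?dvdn_mulr // dvdn1; case: eqP p_pr => // ->.
Qed.

Lemma consecutive_sums (B : set nat) :
  (forall p, prime p -> exists2 b, B b & ~~ (p %| b)%N) ->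
  exists h s, sums_at_most h B s /\ sums_at_most h B s.+1.
Proof.
move=> noprime.
pose D d := (0 < d)%N /\
  exists h s, sums_at_most h B s /\ sums_at_most h B (s + d).
have exD : exists d, `[< D d >].
  (* The prime 2 serves to find a nonzero [b], the difference of the sums [b] and 0. *)
  have [b Bb b2] := noprime 2 isT.
  exists b; apply/asboolP; split; first by case: b b2 {Bb}.
  exists 1, 0; split; last exact: sums_at_most1.
  by exists [::]; split.
have [d /asboolP[d_gt0 [h [s [hs ht]]]] dmin] := ex_minnP exD.
(* The least positive difference of two sums of [B] divides every [b]: the
   remainder of [b] is again such a difference. *)
have dvdB b : B b -> (d %| b)%N.
  move=> Bb; apply: contrapT => /negP; rewrite /dvdn -lt0n => r_gt0.
  suff /dmin : `[< D (b %% d)%N >] by rewrite leqNgt ltn_mod d_gt0.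
  apply/asboolP; split=> //.
  (* With [c = b %/ d], the sums [c * (s + d)] and [b + c * s] differ by [b - c * d = b %% d]. *)
  exists (1 + (b %/ d) * h)%N, ((b %/ d) * (s + d))%N; split.
    by apply: (@sums_at_mostW ((b %/ d) * h)); [lia|exact: sums_at_mostM].
  have -> : ((b %/ d) * (s + d) + b %% d = b + (b %/ d) * s)%N.
    by rewrite {3}(divn_eq b d); lia.
  by apply: sums_at_mostD; [exact: sums_at_most1|exact: sums_at_mostM].
have [d_le1|d_gt1] := leqP d 1.
  have d1 : d = 1 by lia.
  by exists h, s; split=> //; rewrite -addn1 -d1.
have [b /dvdB db /negP[]] := noprime (pdiv d) (pdiv_prime d_gt1).
exact: dvdn_trans (pdiv_dvd d) db.
Qed.

Lemma asymptotic_basis_setD (A P : set nat) :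
  asymptotic_basis A -> finite_set P ->
  (forall p, prime p -> exists2 b, (A `\` P) b & ~~ (p %| b)%N) ->
  asymptotic_basis (A `\` P).
Proof.
move=> [h h_gt0 /finite_setCP[M AM]] /finite_seqP[e PE] /consecutive_sums.
set B := A `\` P => -[l [s [ls ls1]]].
(* A sum of at most [h] terms has at most [h] of them in [P], each at most [m]. *)
pose m := (\max_(i <- e) i)%N; pose V := (h * m)%N.
exists (h + V * l)%N; first by rewrite addn_gt0 h_gt0.
apply/finite_setCP; exists (M + V * s)%N => n leMn.
have [|u [uh uA uE]] := AM (n - V * s)%N; first by lia.
pose v := sumn [seq x <- u | x \in e]; pose w := sumn [seq x <- u | x \notin e].
have uvw : sumn u = (w + v)%N.
  by rewrite addnC -sumn_cat; apply: perm_sumn; rewrite perm_sym perm_filterC.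
have vV : (v <= V)%N.
  rewrite /V /v; apply: (@leq_trans (size [seq x <- u | x \in e] * m)).
    elim: u {uh uA uE uvw v w} => //= x u IH.
    case: ifP => //= xe; rewrite mulSn leq_add //.
    exact: (@leq_bigmax_seq _ e xpredT id x xe isT).
  by rewrite leq_mul2r size_filter (leq_trans (count_size _ _)) ?orbT.
have -> : n = (w + (v * s.+1 + (V - v) * s))%N by nia.
(* The order must not depend on [v]: the trade always uses [V] blocks of at most [l] terms. *)
have -> : (h + V * l = h + (v * l + (V - v) * l))%N by nia.
apply: sums_at_mostD; last by apply: sums_at_mostD; apply: sums_at_mostM.
exists [seq x <- u | x \notin e]; split=> //.
  by rewrite size_filter (leq_trans (count_size _ _)).
move=> x; rewrite mem_filter => /andP[xe /uA Ax]; split=> //.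
by rewrite PE /= => xe'; rewrite xe' in xe.
Qed.

(** Some prime [p] divides everything in [A] outside [P], so [P] contains all elements of [A] not
    divisible by [p]. Removing just these already destroys the basis, and minimality gives
    equality. *)
Lemma essential_subset_prime (A P : set nat) : essential_subset A P ->
  exists2 p, prime p & P = [set a | A a /\ ~~ (p %| a)%N].
Proof.
move=> [[Abasis PA nbasis Pmin] Pfin].
have [p p_pr pAP] : exists2 p, prime p & forall b, (A `\` P) b -> (p %| b)%N.
  apply: contrapT => nop; apply: nbasis; apply: asymptotic_basis_setD => //.
  move=> p p_pr; apply: contrapT => nob; apply: nop; exists p => // b APb.
  by apply: contrapT => /negP pb; apply: nob; exists b.
exists p => //; apply/esym/Pmin; first by move=> a [].
  apply: (@not_asymptotic_basis_dvd p) => // b [Ab nb].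
  by apply: contrapT => /negP pb; apply: nb.
move=> a [Aa pa]; apply: contrapT => nPa.
by move/negP: pa; apply; apply: pAP.
Qed.

Lemma prod_primes_dvd (r : seq nat) (n : nat) :
  uniq r -> all prime r -> all (dvdn^~ n) r -> (\prod_(p <- r) p %| n)%N.
Proof.
elim: r => [|p r IH] /=; first by rewrite big_nil dvd1n.
move=> /andP[pr ur] /andP[p_pr r_pr] /andP[pn rn]; rewrite big_cons.
suff cop : coprime p (\prod_(j <- r) j) by rewrite Gauss_dvd // pn IH.
rewrite big_seq; elim/big_ind: _ => [|x y cx cy|x xr]; first exact: coprimen1.
  by rewrite coprimeMr cx.
rewrite prime_coprime // dvdn_prime2 ?(allP r_pr x) //.
by apply: contra pr => /eqP->.
Qed.

Lemma expn_homo (e : nat) : {homo expn^~ e : m n / (m <= n)%N}.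
Proof. by case: e => // e m n le; rewrite leq_exp2r. Qed.

(** Pigeonhole: every residue modulo [q] is attained by a sum of [h] entries of [0 :: L]. *)
Lemma modulus_le_of_covering (h q : nat) (A : set nat) (L : seq nat) :
  asymptotic_basis_of_order h A -> (0 < q)%N ->
  (forall a, A a -> ~~ (q %| a)%N -> a \in L) -> (q <= (size L).+1 ^ h)%N.
Proof.
move=> /finite_setCP[M AM] q_gt0 AL.
(* Index 0 points to the entry 0: it stands for every multiple of [q] and pads short sums to length
   [h]. *)
pose S (t : h.-tuple 'I_(size L).+1) := sumn [seq nth 0 (0 :: L) i | i : 'I_(size L).+1 <- t].
have /choice[f fE] : forall r : 'I_q, exists t, (S t = r %[mod q])%N.
  (* The shift by [M * q] keeps the residue and reaches the range where all numbers are sums. *)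
  move=> r; have [|s [sh sA sE]] := AM (M * q + r)%N; first by nia.
  pose g a : 'I_(size L).+1 :=
    if (q %| a)%N then ord0 else inord (index a (0 :: L)).
  have gE a : A a -> (nth 0 (0 :: L) (g a) = a %[mod q])%N.
    move=> Aa; rewrite /g; case: ifPn => [/eqP -> |/(AL _ Aa) aL].
      by rewrite mod0n.
    have a0L : a \in 0 :: L by rewrite inE aL orbT.
    by rewrite inordK ?nth_index //; move: a0L; rewrite -index_mem.
  pose t := [seq g a | a <- s] ++ nseq (h - size s) ord0.
  have th : size t == h by rewrite size_cat size_map size_nseq subnKC.
  exists (Tuple th); rewrite -(modnMDl M r) sE /S /= /t map_cat sumn_cat.
  rewrite map_nseq sumn_nseq /= mul0n addn0.
  elim: s sA {sh sE t th} => //= a s IH sA.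
  rewrite -modnDm gE ?IH ?modnDm //; last by apply: sA; rewrite mem_head.
  by move=> x xs; apply: sA; rewrite inE xs orbT.
have f_inj : injective f.
  move=> i j ij; apply/val_inj; move: (fE i); rewrite ij fE.
  by rewrite !modn_small.
by have := leq_card f f_inj; rewrite card_tuple !card_ord.
Qed.

Lemma count_primes_bound (k h : nat) (A : set nat) (r : seq nat) :
  asymptotic_basis_of_order h A -> uniq r -> all prime r ->
  (forall p, p \in r -> exists2 s : seq nat, (size s <= k)%N &
     forall a, A a -> ~~ (p %| a)%N -> a \in s) ->
  (2 ^ size r <= (k * size r).+1 ^ h)%N.
Proof.
move=> Ah ur r_pr rk.
have /choice[e eP] : forall p, exists s : seq nat, p \in r ->
    (size s <= k)%N /\ forall a, A a -> ~~ (p %| a)%N -> a \in s.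
  move=> p; have [/rk[s]|_] := boolP (p \in r); first by exists s.
  by exists [::].
(* An element of [A] outside [L] is divisible by every prime in [r], hence by their product. *)
pose L := flatten [seq e p | p <- r].
have sizeL : (size L <= k * size r)%N.
  rewrite /L; elim: r {ur r_pr rk L} eP => //= p r IH eP.
  rewrite size_cat mulnS leq_add //; first by case: (eP p); rewrite ?mem_head.
  by apply: IH => x xr; apply: eP; rewrite inE xr orbT.
have q_ge : (2 ^ size r <= \prod_(p <- r) p)%N.
  elim: r r_pr {ur rk eP L sizeL} => [|p r IH] /=; first by rewrite big_nil.
  by move=> /andP[/prime_gt1 p2 /IH le]; rewrite big_cons expnS leq_mul.
apply: (leq_trans q_ge).
apply: (@leq_trans ((size L).+1 ^ h)); last exact: expn_homo.
apply: (modulus_le_of_covering _ _ _ _ Ah).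
  by apply: leq_trans q_ge; rewrite expn_gt0.
move=> a Aa qa; have : ~~ all (dvdn^~ a) r.
  by apply: contra qa; apply: prod_primes_dvd.
move=> /allPn[p pr pa]; apply/flattenP; exists (e p); first exact: map_f.
by have [_] := eP p pr; apply.
Qed.

Lemma exp_beats_poly (k h : nat) : exists N, ((k * N).+1 ^ h < 2 ^ N)%N.
Proof.
(* For this [N], [k * N + 1] is at most [2 ^ (5 * t)], so [5 * t * h < (2 ^ t) ^ 4] suffices; it
   follows from [h < t < 2 ^ t] and [3 <= 2 ^ t]. *)
pose t := (k + h).+2; exists (2 ^ (4 * t))%N.
have lt1 : ((k * 2 ^ (4 * t)).+1 <= 2 ^ (5 * t))%N.
  have -> : (5 * t = t + 4 * t)%N by lia.
  rewrite expnD.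
  have kt : (k < 2 ^ t)%N.
    by apply: (@leq_ltn_trans t); [rewrite /t; lia|exact: ltn_expl].
  apply: leq_trans (leq_mul kt (leqnn _)).
  by rewrite mulSn -add1n leq_add2r expn_gt0.
apply: (@leq_ltn_trans ((2 ^ (5 * t)) ^ h)); first exact: expn_homo.
rewrite -expnM ltn_exp2l // [(4 * t)%N]mulnC expnM.
have ht : (h < t)%N by rewrite /t; lia.
have t2 : (2 <= t)%N by rewrite /t; lia.
have := ltn_expl t (isT : 1 < 2); move: (2 ^ t)%N => x tx.
have x2 : (9 <= x ^ 2)%N by nia.
have : (5 * t * h < 9 * x ^ 2)%N by nia.
move/leq_trans; apply.
by rewrite (expnM x 2 2) [X in (_ <= X)%N]expnS expn1 leq_mul2r x2 orbT.
Qed.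

(** This reduces the bound to finite lists; an infinite [T] is excluded too, as it has finite
    subsets of at least [N] elements. *)
Lemma set_nat_card_le (T : set nat) (N : nat) :
  (forall r : seq nat, uniq r -> size r = N -> [set` r] `<=` T -> False) ->
  T #<= `I_N.
Proof.
move=> noN.
have small (X : {fset nat}) : [set` X] `<=` T -> (#|` X| < N)%N.
  move=> XT; rewrite ltnNge; apply/negP => leN.
  apply: (noN (take N X)); rewrite ?take_uniq ?fset_uniq ?size_takel //.
  by move=> x /= /mem_take; apply: XT.
have [/finite_fsetP[X TE]|/(@infinite_set_fset _ T N)[X XT]] := pselect (finite_set T).
  have /card_eq_fsetP XE : #|` X| = #|` X| by [].
  rewrite TE (card_le_eql XE) card_le_II; apply/ltnW/small.
  by rewrite TE.
by rewrite leqNgt small.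
Qed.

Theorem theorem2p1 (k h : nat) (k_gt0 : (0 < k)%N) (h_gt0 : (0 < h)%N) :
  exists phi : nat, forall A : set nat, asymptotic_basis_of_order h A ->
    [set P : set nat | essential_subset A P /\ P #<= `I_k] #<= `I_phi.
Proof.
have [N ltN] := exp_beats_poly k h; exists N => A Ah.
set F := [set P | _].
have /choice[g gE] : forall P : set nat, exists p, essential_subset A P ->
    prime p /\ P = [set a | A a /\ ~~ (p %| a)%N].
  move=> P; have [/essential_subset_prime[p]|] := pselect (essential_subset A P).
    by exists p.
  by exists 0.
have g_inj : {in F &, injective g}.
  move=> P Q /set_mem[/gE[_ PE] _] /set_mem[/gE[_ QE] _] PQ.
  by rewrite PE QE PQ.
(* A prime determines its essential subset, so it is enough to count the primes in the image of
   [g]. *)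
rewrite -(card_le_eql (inj_card_eq g_inj)).
apply: set_nat_card_le => r ur rN rT.
move: ltN; rewrite -rN ltnNge => /negP; apply; apply: (@count_primes_bound k h A) => //.
  by apply/allP => _ /rT[P [/gE[p_pr _] _] <-].
move=> _ /rT[P [/gE[_ PE] Pk] <-].
have Pfin : finite_set P by apply/finite_set_leP; exists k.
exists (fset_set P); first exact: geq_card_fset_set.
by move=> a Aa pa; rewrite in_fset_set //; apply: mem_set; rewrite PE.
Qed.
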